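(* Let $G$ be a graph, and consider the gp achievement game on $G$ in which the vertices played in order are $a_1,b_1,a_2,b_2,\ldots$ ($a_i$ played by A, $b_i$ by B). (i) If A has a strategy such that after the vertex $a_k$, for some $k\ge 1$, is played, the set $\mathrm{Pl}_G(a_1,b_1,\ldots,a_k)\cup\{a_1,b_1,\ldots,a_k\}$ is a general position set of $G$ and $|\mathrm{Pl}_G(a_1,b_1,\ldots,a_k)|$ is even, then A wins the gp achievement game on $G$. (ii) If B has a strategy such that after the vertex $b_k$, for some $k\ge 1$, is played, the set $\mathrm{Pl}_G(a_1,b_1,\ldots,b_k)\cup\{a_1,b_1,\ldots,b_k\}$ is a general position set of $G$ and $|\mathrm{Pl}_G(a_1,b_1,\ldots,b_k)|$ is even, then B wins the gp achievement game on $G$.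
   Context: All graphs are finite and simple. A general position set of a graph $G$ is a set $S\subseteq V(G)$ such that no three vertices of $S$ lie on a common shortest path of $G$. The gp achievement game on $G$: players A and B alternately select vertices of $G$, A first; a selection of a vertex is legal if it has not been selected before and the set of all vertices selected so far (including it) is a general position set of $G$. The game ends when no legal move exists, and the player who selected the last vertex wins; ''a player wins the game'' means that player has a winning strategy. If $x_1,\ldots,x_j$ are the vertices played so far, $\mathrm{Pl}_G(x_1,\ldots,x_j)$ is the set of playable vertices, i.e. vertices $y\notin\{x_1,\ldots,x_j\}$ such that $\{x_1,\ldots,x_j,y\}$ is a general position set of $G$. *)

(* Defs.v *)
From mathcomp Require Import all_boot.
From mathcomp Require Import boolp.

Set Implicit Arguments.
Unset Strict Implicit.
Unset Printing Implicit Defensive.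

Section GeneralPosition.
Variables (T : finType) (e : rel T).

(* [x :: p] is the vertex sequence of the path. *)
Definition shortest_path (x : T) (p : seq T) : Prop :=
  path e x p /\
  forall q : seq T, path e x q -> last x q = last x p -> size p <= size q.

Definition on_common_shortest_path (u v w : T) : Prop :=
  exists (x : T) (p : seq T),
    shortest_path x p /\ [/\ u \in x :: p, v \in x :: p & w \in x :: p].

Definition general_position (S : {set T}) : Prop :=
  forall u v w : T, u \in S -> v \in S -> w \in S ->
    u != v -> u != w -> v != w -> ~ on_common_shortest_path u v w.

Definition Pl (s : seq T) : {set T} :=
  [set y | (y \notin s) && `[< general_position (y |: [set x in s]) >]].

End GeneralPosition.

Inductive player := PlayerA | PlayerB.

Section Game.
Variables (T : finType) (e : rel T).

(* A history lists the selected vertices in chronological order,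
   a_1, b_1, a_2, b_2, ... *)
Definition turn (s : seq T) : player :=
  if odd (size s) then PlayerB else PlayerA.

Definition legal_play (s : seq T) : Prop :=
  forall (t : seq T) (x : T) (u : seq T), s = t ++ x :: u -> x \in Pl e t.

Definition complete_play (s : seq T) : Prop :=
  legal_play s /\ Pl e s = set0.

Definition selected_last (P : player) (s : seq T) : Prop :=
  exists (t : seq T) (x : T), s = rcons t x /\ turn t = P.

(* Values of [sigma] at histories where [P] has no move to make are
   irrelevant. *)
Definition strategy_for (P : player) (sigma : seq T -> T) : Prop :=
  forall s : seq T, legal_play s -> turn s = P -> Pl e s != set0 ->
    sigma s \in Pl e s.

Definition follows (P : player) (sigma : seq T -> T) (s : seq T) : Prop :=
  forall (t : seq T) (x : T) (u : seq T),
    s = t ++ x :: u -> turn t = P -> x = sigma t.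

Definition wins (P : player) : Prop :=
  exists sigma : seq T -> T, strategy_for P sigma /\
    forall s : seq T, complete_play s -> follows P sigma s ->
      selected_last P s.

End Game.

(* Main.v *)
Require Import Defs.
From mathcomp Require Import all_boot.
From mathcomp Require Import boolp.

Set Implicit Arguments.
Unset Strict Implicit.
Unset Printing Implicit Defensive.

(** Let [t] be the position reached by the given strategy at which
    [Pl t] together with the selected vertices is in general position.  Only
    vertices of [Pl t] can be selected from then on, and each of them stays
    playable until it is selected, so every complete play through [t] has
    length [size t + #|Pl t|].  As [#|Pl t|] is even, the player who moved last
    at [t] also moves last in the game: the given strategy already wins. *)

Lemma general_position_subset (T : finType) (e : rel T) (A B : {set T}) :
  A \subset B -> general_position e B -> general_position e A.
Proof.
by move=> /subsetP sAB gpB u v w uA vA wA; apply: gpB; apply: sAB.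
Qed.

Lemma legal_play_uniq (T : finType) (e : rel T) (s : seq T) :
  legal_play e s -> uniq s.
Proof.
elim/last_ind: s => // s x IHs legal; rewrite rcons_uniq.
apply/andP; split.
  by have := legal s x [::]; rewrite cats1 inE => /(_ erefl) /andP[].
apply: IHs => t y u def_s; apply: (legal t y (rcons u x)).
by rewrite def_s rcons_cat.
Qed.

(** General position passes to subsets, so a vertex playable after further selections was already
    playable at [t]. *)
Lemma legal_play_suffix (T : finType) (e : rel T) (t u : seq T) :
  legal_play e (t ++ u) -> {subset u <= Pl e t}.
Proof.
move=> legal x xu; case/splitPr: xu legal => u1 u2 legal.
have := legal (t ++ u1) x u2; rewrite -catA => /(_ erefl).
rewrite !inE mem_cat negb_or => /andP[/andP[-> _] /asboolP gp] /=.
apply/asboolP; apply: general_position_subset gp.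
by apply/subsetP=> y; rewrite !inE mem_cat => /orP[->|->] //; rewrite orbT.
Qed.

(** A vertex of [Pl e t] missing from [u] would still be playable at the end, since together with
    [t] and [u] it stays inside the general position set of the hypothesis; this contradicts
    completeness. *)
Lemma complete_play_suffix (T : finType) (e : rel T) (t u : seq T) :
  complete_play e (t ++ u) -> general_position e (Pl e t :|: [set x in t]) ->
  u =i Pl e t.
Proof.
move=> [legal done] gp x; have sub := legal_play_suffix legal.
apply/idP/idP=> [/sub //|xPl]; apply/negPn/negP=> xu.
suff: x \in Pl e (t ++ u) by rewrite done inE.
rewrite inE mem_cat negb_or xu andbT.
move: (xPl); rewrite inE => /andP[-> _] /=; apply/asboolP.
apply: general_position_subset gp; apply/subsetP=> y.
rewrite in_setU1 in_setU !(inE, mem_cat) => /or3P[/eqP->|->|/sub].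
- by move: xPl; rewrite inE => ->.
- by rewrite orbT.
- by rewrite inE => ->.
Qed.

Lemma size_complete_play (T : finType) (e : rel T) (t u : seq T) :
  complete_play e (t ++ u) -> general_position e (Pl e t :|: [set x in t]) ->
  size (t ++ u) = size t + #|Pl e t|.
Proof.
move=> cpl gp; rewrite size_cat -(eq_card (complete_play_suffix cpl gp)).
congr addn; apply/esym/card_uniqP.
by case: cpl => /legal_play_uniq; rewrite cat_uniq => /and3P[].
Qed.

(** Reduces the winner to the parity of the length. Without [0 < size s], the empty history, where A
    is to move, would credit B with a last move. *)
Lemma selected_lastE (T : finType) (P : player) (s : seq T) :
  selected_last P s <-> 0 < size s /\ turn s <> P.
Proof.
split=> [[t [x [-> <-]]]|].
  by rewrite /turn size_rcons /=; split=> //; case: odd.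
case/lastP: s => [[]//|t x [_ turnP]]; exists t, x; split=> //.
by move: turnP; rewrite /turn size_rcons /=; case: odd; case: P.
Qed.

(** Common core of both parts: the index [k] matters only through who moved last at [t]. *)
Lemma wins_of_even_Pl (T : finType) (e : rel T) (P : player)
    (sigma : seq T -> T) :
  strategy_for e P sigma ->
  (forall s, complete_play e s -> follows P sigma s ->
    exists t u, [/\ s = t ++ u, selected_last P t,
      general_position e (Pl e t :|: [set x in t]) & ~~ odd #|Pl e t|]) ->
  wins e P.
Proof.
move=> strat reach; exists sigma; split=> // s cpl fol.
have [t [u [def_s /selected_lastE[t_gt0 turnP] gp even_Pl]]] := reach s cpl fol.
rewrite def_s in cpl *; have sz := size_complete_play cpl gp.
(* Adding the even number [#|Pl e t|] to [size t] does not change whose turn it is. *)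
apply/selected_lastE; rewrite /turn sz oddD (negbTE even_Pl) addbF.
by split=> //; rewrite addn_gt0 t_gt0.
Qed.

Theorem theorem2p2 (T : finType) (e : rel T)
    (e_sym : symmetric e) (e_irr : irreflexive e) :
  ((exists sigma : seq T -> T, strategy_for e PlayerA sigma /\
      forall s : seq T, complete_play e s -> follows PlayerA sigma s ->
        exists (k : nat) (t u : seq T),
          [/\ 1 <= k, s = t ++ u, size t = 2 * k - 1,
              general_position e (Pl e t :|: [set x in t])
            & ~~ odd #|Pl e t|]) ->
    wins e PlayerA)
  /\
  ((exists sigma : seq T -> T, strategy_for e PlayerB sigma /\
      forall s : seq T, complete_play e s -> follows PlayerB sigma s ->
        exists (k : nat) (t u : seq T),
          [/\ 1 <= k, s = t ++ u, size t = 2 * k,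
              general_position e (Pl e t :|: [set x in t])
            & ~~ odd #|Pl e t|]) ->
    wins e PlayerB).
Proof.
split=> -[sigma [strat reach]]; apply: (wins_of_even_Pl strat) => s cpl fol;
  (* Excluding [k = 0] makes [t] nonempty and turns the truncated [2 * k.+1 - 1] into the odd number
     [k.*2.+1]. *)
  have [[|k] [t [u [// _ def_s sz gp even_Pl]]]] := reach s cpl fol;
  exists t, u; split=> //; apply/selected_lastE; rewrite /turn sz mul2n.
- by rewrite doubleS subn1 /= odd_double.
- by rewrite odd_double.
Qed.
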